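(* Let $n\in\mathbb{N}$, $d\in\mathbb{N}_0$, $\boldsymbol{c}=(c_1,\ldots,c_d)\in(\mathbb{N}\setminus\{2\})^d$ and $\boldsymbol{z}=(z_0,\ldots,z_d)\in\mathbb{C}^{d+1}$ with $|z_j|<1$ for $j=0,\ldots,d$. Put $c_0=1$, $c_{d+1}=0$, $\delta_i=\delta(c_i)+\delta(c_{i+1})$ for $0\le i\le d$, and $k_{-1}=0$. Then $$G_n(\boldsymbol{c};\boldsymbol{z})=\frac{n\binom{2n}{n}}{2^{4n-2}}\sum_{n\geq k_0\geq k_1\geq\cdots\geq k_d\geq1}\binom{2n-1}{n-k_0}\prod_{i=0}^{d}\frac{(-1)^{k_i\delta_i}(2k_i-1)^{\delta_i-1}}{(2k_i-1)^2-z_i^2}V_{k_{i-1},k_i}^{\#}(\{1\}^{c_i-3}).$$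
   Context: For an index (finite sequence of positive integers) $\boldsymbol{s}=(s_1,\ldots,s_r)$ and $n\in\mathbb{N}$, the multiple $t$-harmonic star sum is $t^{\star}_n(\boldsymbol{s})=\sum_{n\geq k_1\geq\cdots\geq k_r\geq1}\prod_{j=1}^r(2k_j-1)^{-s_j}$, with $t^\star_n(\emptyset)=1$. $\{s\}^a$ denotes $s$ repeated $a$ times; for $a\le 0$, $\{1\}^{a}$ is the empty index. The generating function is $G_n(\boldsymbol{c};\boldsymbol{z})=\sum_{a_0,\ldots,a_d\geq0}t^{\star}_n(\{2\}^{a_0},c_1,\{2\}^{a_1},\ldots,c_d,\{2\}^{a_d})z_0^{2a_0}\cdots z_d^{2a_d}$. For $k,m\in\mathbb{N}_0$ let $\triangle(k,m)=0$ if $k=m$ and $1$ otherwise. For an index $\boldsymbol{s}=(s_1,\ldots,s_r)$: if $\boldsymbol{s}\ne\emptyset$ and $k\ge m$, $V^{\#}_{k,m}(\boldsymbol{s})=\frac{2k-1}{2m-1}\sum_{k\geq l_1\geq\cdots\geq l_r\geq m}\frac{2^{\triangle(k,l_1)+\triangle(l_1,l_2)+\cdots+\triangle(l_r,m)}}{(2l_1-1)^{s_1}\cdots(2l_r-1)^{s_r}}$; otherwise $V^{\#}_{k,m}(\boldsymbol{s})=\left(2\cdot\frac{2k-1}{2m-1}\right)^{\triangle(k,m)}$. For $c\in\mathbb{N}_0$, $\delta(c)=2$ if $c=0$, $\delta(c)=1$ if $c=1$, $\delta(c)=0$ if $c\ge3$. *)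

(* Defs.v *)
From HB Require Import structures.
From mathcomp Require Import all_boot all_order all_algebra.
From mathcomp Require Import all_classical all_reals all_analysis.
From mathcomp Require Import complex.
Set Implicit Arguments. Unset Strict Implicit. Unset Printing Implicit Defensive.
Import Order.TTheory GRing.Theory Num.Theory.
Import numFieldNormedType.Exports.
Local Open Scope ring_scope.

Section Defs.
Variable F : fieldType.

(* the odd number 2k-1, computed in F (so that k = 0 gives -1) *)
Definition odd2 (k : nat) : F := (2 * k)%:R - 1.

Fixpoint tstar (n : nat) (s : seq nat) {struct s} : F :=
  match s with
  | [::] => 1
  | s1 :: s' => \sum_(1 <= k < n.+1) (odd2 k ^- s1 * tstar k s')
  end.

Definition tri (k m : nat) : nat := (k != m)%N.

Fixpoint Wsum (p : nat) (s : seq nat) (m : nat) {struct s} : F :=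
  match s with
  | [::] => 2 ^+ tri p m
  | s1 :: s' => \sum_(m <= l < p.+1) (2 ^+ tri p l * odd2 l ^- s1 * Wsum l s' m)
  end.

Definition Vsharp (k m : nat) (s : seq nat) : F :=
  if (s != [::]) && (m <= k)%N then odd2 k / odd2 m * Wsum k s m
  else (2 * (odd2 k / odd2 m)) ^+ tri k m.

End Defs.

(* delta(c) = 2 if c = 0, 1 if c = 1, 0 if c >= 3 (c = 2 never occurs) *)
Definition delta (c : nat) : nat :=
  match c with 0 => 2 | 1 => 1 | _ => 0 end.

Definition oext (T : Type) (m : nat) (f : 'I_m -> T) (x0 : T) (j : nat) : T :=
  match (insub j : option 'I_m) with Some o => f o | None => x0 end.

(* c_i for 0 <= i <= d+1, with c_0 = 1 and c_{d+1} = 0; c : 'I_d -> nat gives c_1..c_d *)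
Definition cext (d : nat) (c : 'I_d -> nat) (i : nat) : nat :=
  if i is j.+1 then oext c 0%N j else 1%N.

Definition deltai (d : nat) (c : 'I_d -> nat) (i : nat) : nat :=
  (delta (cext c i) + delta (cext c i.+1))%N.

Definition Gindex (d : nat) (c : 'I_d -> nat) (a : 'I_d.+1 -> nat) : seq nat :=
  nseq (a ord0) 2%N ++ flatten [seq c i :: nseq (a (lift ord0 i)) 2%N | i <- enum 'I_d].

Definition Gpartial (C : fieldType) (n d : nat) (c : 'I_d -> nat) (z : 'I_d.+1 -> C)
    (N : nat) : C :=
  \sum_(a : {ffun 'I_d.+1 -> 'I_N.+1})
     (tstar C n (Gindex c (fun j => nat_of_ord (a j)))
      * \prod_(j < d.+1) z j ^+ (2 * a j)).

Definition kprev (n d : nat) (k : 'I_d.+1 -> 'I_n.+1) (i : nat) : nat :=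
  if i is j.+1 then oext (fun o => nat_of_ord (k o)) 0%N j else 0%N.

Definition Grhs (C : numFieldType) (n d : nat) (c : 'I_d -> nat) (z : 'I_d.+1 -> C) : C :=
  (n * 'C(2 * n, n))%:R / 2 ^+ (4 * n - 2)
  * \sum_(k : {ffun 'I_d.+1 -> 'I_n.+1} |
            [forall i : 'I_d.+1, forall j : 'I_d.+1, (i <= j)%N ==> (k j <= k i)%N]
            && [forall i : 'I_d.+1, (0 < k i)%N])
      ('C(2 * n - 1, n - k ord0)%:R
       * \prod_(i < d.+1)
           ((-1) ^+ (k i * deltai c i)
            * odd2 C (k i) ^ ((deltai c i)%:Z - 1)
            / (odd2 C (k i) ^+ 2 - z i ^+ 2)
            * Vsharp C (kprev k i) (k i) (nseq (cext c i - 3) 1%N))).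

(* Main.v *)
(* Write o(k) = 2k-1 and b(n,k) = n C(2n,n) C(2n-1,n-k) / 2^(4n-2). Summing out the
   leading string of 2's, G_n(c;z) is characterised by
     G_n (1 - z_0^2/o(n)^2) = G_(n-1) + o(n)^(-c_1) G_n(c_2,...,c_d; z_1,...,z_d).
   Since b(n,k) (1 - o(k)^2/o(n)^2) = b(n-1,k), the ansatz
   G_n = sum_k b(n,k) u(k) / (o(k)^2 - z_0^2) solves it as soon as
   sum_k b(n,k) u(k) = o(n)^(2-c_1) sum_k b(n,k) v(k), where v is the coefficient sequence
   of the shorter index. Telescoping in k produces such a u from v when the factor is
   o(n) (c_1 = 1) or 1/o(n) (c_1 = 3), the case c_1 > 3 iterates the latter, and unfolding
   the recursion over c gives the V^# kernels. Convergence of the truncated sums follows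
   from the same recursion: cutting a_0 at N adds an error z_0^(2N) times a bounded term. *)

Require Import Defs.
From HB Require Import structures.
From mathcomp Require Import all_boot all_order all_algebra.
From mathcomp Require Import all_classical all_reals all_analysis.
From mathcomp Require Import complex.
From mathcomp Require Import zify ring.
Import Order.TTheory GRing.Theory Num.Theory.
Import numFieldNormedType.Exports.
Local Open Scope ring_scope.
Local Open Scope complex_scope.
Local Open Scope classical_set_scope.
Set Implicit Arguments.
Unset Strict Implicit.
Unset Printing Implicit Defensive.

(** * The weights b(n,k): ratios and telescoping sums *)

Section Weights.
Variable F : numFieldType.
Local Notation odd2 := (odd2 F).

Lemma odd2S k : odd2 k.+1 = (2 * k + 1)%:R.
Proof. by rewrite /odd2 -[1]/(1%:R) -natrB; [congr (_%:R)|]; lia. Qed.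

Lemma odd2_neq0 k : odd2 k != 0.
Proof.
case: k => [|k]; first by rewrite /odd2 muln0 sub0r oppr_eq0 oner_eq0.
by rewrite odd2S pnatr_eq0; lia.
Qed.

(* Truncated subtraction makes [bweight n k] nonzero for k > n; only k <= n is meant. *)
Definition bweight (n k : nat) : F :=
  (n * 'C(2 * n, n))%:R / 2 ^+ (4 * n - 2) * 'C(2 * n - 1, n - k)%:R.

(** Ratio of neighbouring entries in one row of Pascal's triangle; every telescoping sum in k below
    rests on it. *)
Lemma bweightS n k : (k < n)%N ->
  (n%:R - k%:R) * bweight n k = (n%:R + k%:R) * bweight n k.+1.
Proof.
move=> kn; rewrite /bweight -natrB 1?ltnW// -natrD.
rewrite mulrCA [RHS]mulrCA -!natrM; congr (_ * _%:R).
rewrite (_ : (n - k = (n - k.+1).+1)%N); last by lia.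
rewrite mul_bin_left; congr (_ * _)%N; lia.
Qed.

(** The factor equals 4(n+1-k)(n+k)/o(n+1)^2, which cancels against the growth of the central
    binomial ([e1]) and of C(2n-1,n-k) ([e2]). *)
Lemma bweight_pred n k : (0 < k <= n)%N ->
  bweight n.+1 k * (1 - odd2 k ^+ 2 / odd2 n.+1 ^+ 2) = bweight n k.
Proof.
case/andP; case: k => [//|k] _ kn.
have nn0 : odd2 n.+1 != 0 by exact: odd2_neq0.
have n0 : n%:R != 0 :> F by rewrite pnatr_eq0; lia.
have two0 : 2%:R != 0 :> F by rewrite pnatr_eq0.
pose a := 'C(2 * n, n); pose b := 'C(2 * n - 1, n - k.+1).
have e1 : (n.+1 * 'C(2 * n.+1, n.+1) = 2 * (2 * n + 1) * a)%N.
  have := mul_bin_diag (2 * n.+1) n.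
  have := mul_bin_down (2 * n).+1 n.
  rewrite -/a (_ : (2 * n.+1).-1 = (2 * n).+1)%N; last by lia.
  rewrite (_ : ((2 * n).+1 - n = n.+1)%N) /=; last by lia.
  by move=> h1 h2; rewrite -h2; nia.
have e2 : ((n - k) * ((n + k.+1) * 'C(2 * n.+1 - 1, n.+1 - k.+1))
           = (2 * n + 1) * (2 * n) * b)%N.
  have := mul_bin_diag (2 * n.+1 - 1) (n - k.+1).
  have := mul_bin_down (2 * n) (n - k.+1).
  rewrite (_ : (2 * n.+1 - 1).-1 = 2 * n)%N; last by lia.
  rewrite (_ : (n - k.+1).+1 = n - k)%N; last by lia.
  rewrite (_ : n.+1 - k.+1 = n - k)%N; last by lia.
  rewrite (_ : (2 * n - (n - k.+1) = n + k.+1)%N); last by lia.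
  rewrite (_ : (2 * n).-1 = 2 * n - 1)%N -/b; last by lia.
  by move=> h1 h2; rewrite mulnCA -h2; nia.
have -> : 1 - odd2 k.+1 ^+ 2 / odd2 n.+1 ^+ 2 =
    4 * ((n - k) * (n + k.+1))%:R / odd2 n.+1 ^+ 2.
  apply: (mulIf (expf_neq0 2 nn0)).
  rewrite mulrBl mul1r !mulfVK ?expf_neq0// !odd2S natrM natrB; last by lia.
  by rewrite !natrD -natr1; ring.
rewrite /bweight e1 -/b.
have -> : (4 * n.+1 - 2 = (4 * n - 2) + 4)%N by lia.
rewrite exprD.
move: e2 => /(congr1 (fun x => x%:R : F)).
set c := 'C(2 * n.+1 - 1, _); rewrite !natrM => e2.
have -> : (2 : F) * (2 * n + 1)%:R * a%:R / (2 ^+ (4 * n - 2) * 2 ^+ 4) * c%:R *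
   (4 * ((n - k)%:R * (n + k.+1)%:R) / odd2 n.+1 ^+ 2) =
   2 * (2 * n + 1)%:R * a%:R / (2 ^+ (4 * n - 2) * 2 ^+ 4) * 4 / odd2 n.+1 ^+ 2 *
   ((n - k)%:R * ((n + k.+1)%:R * c%:R)) by ring.
rewrite e2 odd2S natrD natrM -/a.
have h : 2 * n%:R + 1 != 0 :> F by move: nn0; rewrite odd2S natrD natrM.
have p0 : 2 ^+ (4 * n - 2) != 0 :> F by rewrite expf_neq0.
by field; rewrite p0 h.
Qed.

(** The primitive [t] vanishes at k = n, so only the lower boundary remains. Used for c = 1, where a
    factor o(n) must be produced. *)
Lemma tail_sum_odd2 n j : (j <= n)%N ->
  \sum_(j <= k < n) 2 * odd2 k.+1 * bweight n k.+1 =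
  (odd2 n - odd2 j) * bweight n j.
Proof.
move=> jn; pose t k := - ((odd2 n - odd2 k) * bweight n k).
have -> : (odd2 n - odd2 j) * bweight n j = t n - t j.
  by rewrite /t subrr mul0r oppr0 sub0r opprK.
rewrite -telescope_sumr//; apply: eq_big_nat => k /andP[_ kn].
have e := bweightS kn.
have -> : t k.+1 - t k = 2 * ((n%:R - k%:R) * bweight n k)
    - (odd2 n - odd2 k.+1) * bweight n k.+1.
  by rewrite /t /Defs.odd2 !natrM; ring.
by rewrite e /Defs.odd2 !natrM -natr1; ring.
Qed.

(** The same device with alternating signs; it produces the factor 1/o(n). *)
Lemma tail_sum_alt n j : (j <= n)%N ->
  2 * \sum_(j <= k < n) (-1) ^+ k.+1 * bweight n k.+1 =
  (-1) ^+ j * bweight n j * (odd2 j / odd2 n - 1).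
Proof.
move=> jn; pose t k := - ((-1) ^+ k * bweight n k * (odd2 k / odd2 n - 1)).
have nn0 := odd2_neq0 n.
have oE m : odd2 m = 2 * m%:R - 1 by rewrite /Defs.odd2 natrM.
have -> : (-1) ^+ j * bweight n j * (odd2 j / odd2 n - 1) = t n - t j.
  by rewrite /t mulfV// subrr mulr0 oppr0 sub0r opprK.
rewrite -telescope_sumr// mulr_sumr; apply: eq_big_nat => k /andP[_ kn].
have e := bweightS kn.
have -> : t k.+1 - t k = (-1) ^+ k / odd2 n *
   ((odd2 k.+1 - odd2 n) * bweight n k.+1 - 2 * ((n%:R - k%:R) * bweight n k)).
  by rewrite /t exprS !oE -natr1; field; rewrite -oE.
by rewrite e exprS !oE -natr1; field; rewrite -oE.
Qed.

(** Frees the empty index from a source term in its recursion from n = 2 on. *)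
Lemma sum_alt_odd2 n : (1 < n)%N ->
  \sum_(1 <= k < n.+1) bweight n k * ((-1) ^+ k * odd2 k) = 0.
Proof.
move=> n1; have n10 : n%:R - 1 != 0 :> F.
  by rewrite subr_eq0 (eqr_nat F n 1); lia.
apply: (mulfI n10); rewrite mulr0 big_add1 /=.
(* The factor n-1 turns the summand into a difference of [t], which vanishes both at k = 0 and at k
   = n. *)
pose t k := (-1) ^+ k * bweight n k * (n%:R - k%:R) * k%:R : F.
transitivity (t n - t 0%N); last by rewrite /t subrr mulr0 mul0r mulr0 subr0.
rewrite -telescope_sumr// mulr_sumr; apply: eq_big_nat => k /andP[_ kn].
have e := bweightS kn.
have -> : t k.+1 - t k = (-1) ^+ k.+1 * (bweight n k.+1 * (n%:R - k.+1%:R) * k.+1%:R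
   + ((n%:R - k%:R) * bweight n k) * k%:R).
  by rewrite /t exprS; ring.
by rewrite e /Defs.odd2 !natrM -natr1; ring.
Qed.

(** * Operators on coefficient sequences *)

Lemma exchange_triangle (f : nat -> nat -> F) m n :
  \sum_(m <= k < n) \sum_(m <= x < k.+1) f k x =
  \sum_(m <= x < n) \sum_(x <= k < n) f k x.
Proof.
transitivity (\sum_(m <= k < n) \sum_(m <= x < n | (x < k.+1)%N) f k x).
  by apply: eq_big_nat => k /andP[_ kn]; rewrite (big_nat_widen _ _ n).
rewrite (exchange_big_dep_nat xpredT)//=; apply: eq_big_nat => x /andP[mx _].
by rewrite [RHS](big_nat_widenl _ m).
Qed.

Lemma sum_tri (f : nat -> F) n x : (x <= n)%N ->
  \sum_(x <= k < n.+1) 2 ^+ tri k x * f k = f x + 2 * \sum_(x <= k < n) f k.+1.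
Proof.
move=> xn; rewrite big_ltn// big_add1/= /tri eqxx mul1r; congr (_ + _).
rewrite mulr_sumr; apply: eq_big_nat => k /andP[xk _].
by rewrite (_ : k.+1 != x)//; lia.
Qed.

(** For the empty index [tri k m] is also the exponent of the ratio o(k)/o(m); at k = m that ratio
    is 1, so both branches share one form. *)
Lemma Vsharp_Wsum k m s : (m <= k)%N ->
  Vsharp F k m s = odd2 k / odd2 m * Wsum F k s m.
Proof.
move=> mk; rewrite /Vsharp mk andbT; case: s => [|//] /=.
rewrite /tri; case: (eqVneq k m) => [->|_] /=; first by rewrite mulfV ?odd2_neq0 ?mulr1.
by rewrite !expr1 mulrC.
Qed.

(* On coefficient sequences, [altconv [::]] is division of sum_k b(n,k) v(k) by 2n-1. *)
Definition altconv (s : seq nat) (v : nat -> F) (k : nat) : F :=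
  \sum_(1 <= x < k.+1) Wsum F k s x * ((-1) ^+ (k + x) / odd2 x * v x).

(** The outermost variable l of [Wsum] splits the sign as (-1)^(k+l) (-1)^(l+x), so each leading 1
    composes with one more division by 2n-1. *)
Lemma altconv_cons1 s v k : altconv (1%N :: s) v k = altconv [::] (altconv s v) k.
Proof.
rewrite /altconv /=.
under eq_bigr do rewrite mulr_suml.
rewrite -exchange_triangle; apply: eq_big_nat => l _.
rewrite !mulr_sumr; apply: eq_bigr => x _.
have -> : (-1) ^+ (k + x) = (-1) ^+ (k + l) * (-1) ^+ (l + x) :> F.
  by rewrite !exprD -mulrA [_ ^+ l * (_ * _)]mulrA -[_ ^+ l * _ ^+ l]expr2 sqrr_sign mul1r.
by rewrite expr1; ring.
Qed.

(** After the exchange, the inner sum is the diagonal term plus twice an alternating tail, which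
    collapses to (-1)^x b(n,x) o(x)/o(n). *)
Lemma sum_bweight_altconv_nil n v :
  \sum_(1 <= k < n.+1) bweight n k * altconv [::] v k =
  (odd2 n)^-1 * \sum_(1 <= k < n.+1) bweight n k * v k.
Proof.
rewrite /altconv.
under eq_bigr do rewrite mulr_sumr.
rewrite exchange_triangle mulr_sumr; apply: eq_big_nat => x /andP[x0 xn] /=.
transitivity ((-1) ^+ x / odd2 x * v x *
    \sum_(x <= k < n.+1) 2 ^+ tri k x * ((-1) ^+ k * bweight n k)).
  by rewrite mulr_sumr; apply: eq_bigr => k _; rewrite exprD; ring.
rewrite sum_tri// tail_sum_alt//.
have nn0 := odd2_neq0 n; have x00 := odd2_neq0 x.
have -> : (-1) ^+ x * bweight n x + (-1) ^+ x * bweight n x * (odd2 x / odd2 n - 1)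
  = (-1) ^+ x * (bweight n x * (odd2 x / odd2 n)) by ring.
have -> : (-1) ^+ x / odd2 x * v x * ((-1) ^+ x * (bweight n x * (odd2 x / odd2 n)))
  = (-1) ^+ x * (-1) ^+ x * ((odd2 x)^-1 * odd2 x) * ((odd2 n)^-1 * (bweight n x * v x)).
  by ring.
by rewrite -expr2 sqrr_sign mulVf// !mul1r.
Qed.

Lemma sum_bweight_altconv n m v :
  \sum_(1 <= k < n.+1) bweight n k * altconv (nseq m 1%N) v k =
  odd2 n ^- m.+1 * \sum_(1 <= k < n.+1) bweight n k * v k.
Proof.
elim: m => [|m IH]; first by rewrite sum_bweight_altconv_nil.
under eq_bigr do rewrite altconv_cons1.
by rewrite sum_bweight_altconv_nil// IH [in RHS]exprS invfM mulrA.
Qed.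

(* The map v |-> u dividing sum_k b(n,k) v(k) by (2n-1)^(c-2). *)
Definition step (c : nat) (v : nat -> F) (k : nat) : F :=
  (-1) ^+ (k * (1 + delta c)) * odd2 k ^ ((delta c)%:Z - 1) *
  \sum_(1 <= x < k.+1) Vsharp F k x (nseq (c - 3) 1%N) *
    ((-1) ^+ (x * (1 + delta c)) * odd2 x ^+ delta c * v x).

Lemma step1E v k :
  step 1 v k = \sum_(1 <= x < k.+1) 2 ^+ tri k x * (odd2 k * v x).
Proof.
rewrite /step /= subrr expr0z mulr1 mulnC exprM sqrrN !expr1n mul1r.
apply: eq_big_nat => x /andP[_ xk]; rewrite Vsharp_Wsum//=.
rewrite mulnC exprM sqrrN !expr1n mul1r expr1.
by have x0 := odd2_neq0 x; field.
Qed.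

Lemma step_ge3E c v k : (2 < c)%N -> step c v k = altconv (nseq (c - 3) 1%N) v k.
Proof.
move=> c2; rewrite /step /altconv (_ : delta c = 0%N); last by case: c c2 => [|[|[]]].
rewrite mulr_sumr; apply: eq_big_nat => x /andP[_ xk]; rewrite Vsharp_Wsum//=.
have k0 := odd2_neq0 k; have x0 := odd2_neq0 x.
rewrite !muln1 sub0r exprN1 expr0 mulr1 exprD.
by field; rewrite k0 x0.
Qed.

(** For c >= 3 this is c-2 successive divisions by o(n). For c = 1 the inner sum o(x) b(n,x) + (o(n)
    - o(x)) b(n,x) reduces to o(n) b(n,x). *)
Lemma sum_bweight_step n c v : (0 < c)%N -> c != 2%N ->
  \sum_(1 <= k < n.+1) bweight n k * step c v k =
  odd2 n ^+ 2 * odd2 n ^- c * \sum_(1 <= k < n.+1) bweight n k * v k.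
Proof.
move=> c0 c2; have nn0 := odd2_neq0 n.
have [c3|c3] := leqP 3 c.
  under eq_bigr do rewrite step_ge3E//.
  rewrite sum_bweight_altconv//; congr (_ * _).
  rewrite {2}(_ : c = (2 + (c - 3).+1)%N); last by lia.
  by rewrite exprD invfM mulVKf// expf_neq0.
have -> : c = 1%N by lia.
rewrite expr1 expr2 mulfK// mulr_sumr.
under eq_bigr do rewrite step1E mulr_sumr.
rewrite exchange_triangle; apply: eq_big_nat => x /andP[x0 xn] /=.
transitivity (v x * \sum_(x <= k < n.+1) 2 ^+ tri k x * (odd2 k * bweight n k)).
  by rewrite mulr_sumr; apply: eq_bigr => k _; ring.
rewrite sum_tri// mulr_sumr; under [X in _ + X]eq_bigr do rewrite mulrA.
by rewrite tail_sum_odd2//; ring.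
Qed.

(** Write 1 - y^2/o(n+1)^2 as (1 - o(k)^2/o(n+1)^2) + (o(k)^2 - y^2)/o(n+1)^2: the first part lowers
    the weight to n, the second cancels the denominator. *)
Lemma sum_bweight_rec (u : nat -> F) (y : F) n :
    (forall k, odd2 k ^+ 2 - y ^+ 2 != 0) ->
  (\sum_(1 <= k < n.+2) bweight n.+1 k * (u k / (odd2 k ^+ 2 - y ^+ 2))) *
    (1 - y ^+ 2 / odd2 n.+1 ^+ 2) =
  \sum_(1 <= k < n.+1) bweight n k * (u k / (odd2 k ^+ 2 - y ^+ 2)) +
  odd2 n.+1 ^- 2 * \sum_(1 <= k < n.+2) bweight n.+1 k * u k.
Proof.
move=> y0; have nn0 := odd2_neq0 n.+1.
have -> : \sum_(1 <= k < n.+1) bweight n k * (u k / (odd2 k ^+ 2 - y ^+ 2)) =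
  \sum_(1 <= k < n.+2) bweight n.+1 k * (1 - odd2 k ^+ 2 / odd2 n.+1 ^+ 2) *
     (u k / (odd2 k ^+ 2 - y ^+ 2)).
  (* The added term k = n+1 is zero because of the factor 1 - o(k)^2/o(n+1)^2. *)
  rewrite [RHS]big_nat_recr//= mulfV ?expf_neq0// subrr mulr0 mul0r addr0.
  by apply: eq_big_nat => k kn; rewrite bweight_pred.
rewrite mulr_suml mulr_sumr -big_split/=; apply: eq_big_nat => k _.
by field; rewrite ?y0 ?nn0.
Qed.

(** * The closed form, by recursion over c *)

Fixpoint coef (d : nat) : ('I_d -> nat) -> ('I_d.+1 -> F) -> nat -> F :=
  match d with
  | 0 => fun _ z k => - 2 * ((-1) ^+ k * odd2 k) / (odd2 k ^+ 2 - z ord0 ^+ 2)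
  | _.+1 => fun c z k =>
      step (c ord0) (coef (fun i => c (lift ord0 i)) (fun i => z (lift ord0 i))) k
      / (odd2 k ^+ 2 - z ord0 ^+ 2)
  end.

Definition closed_form (d : nat) (c : 'I_d -> nat) (z : 'I_d.+1 -> F) (n : nat) : F :=
  \sum_(1 <= k < n.+1) bweight n k * coef c z k.

(** This fixes the constant -2 in [coef]: b(1,1) = 1/2 and the sign at k = 1 is -1. *)
Lemma closed_form0_1 (c : 'I_0 -> nat) (z : 'I_1 -> F) :
    1 - z ord0 ^+ 2 != 0 ->
  closed_form c z 1 * (1 - z ord0 ^+ 2) = 1.
Proof.
move=> z0; rewrite /closed_form big_nat1 /bweight /= odd2S muln0 add0n bin0 expr1n.
rewrite !binE /=.
have -> : (1 * (2`! %/ (1`! * (2 - 1)`!)))%N = 2%N by [].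
by field; rewrite z0 ?pnatr_eq0.
Qed.

(** The source term in [sum_bweight_rec] is a multiple of the sum in [sum_alt_odd2]. *)
Lemma closed_form0_rec (c : 'I_0 -> nat) (z : 'I_1 -> F) n :
    (forall k, odd2 k ^+ 2 - z ord0 ^+ 2 != 0) ->
  closed_form c z n.+2 * (1 - z ord0 ^+ 2 / odd2 n.+2 ^+ 2) = closed_form c z n.+1.
Proof.
move=> z0; rewrite /closed_form /= (sum_bweight_rec (fun k => - 2 * ((-1) ^+ k * odd2 k)))//.
under [X in _ * X]eq_bigr do rewrite mulrCA.
by rewrite -mulr_sumr sum_alt_odd2// !mulr0 addr0.
Qed.

Lemma closed_formS_rec d (c : 'I_d.+1 -> nat) (z : 'I_d.+2 -> F) n :
    (0 < c ord0)%N -> c ord0 != 2%N ->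
    (forall k, odd2 k ^+ 2 - z ord0 ^+ 2 != 0) ->
  closed_form c z n.+1 * (1 - z ord0 ^+ 2 / odd2 n.+1 ^+ 2) =
  closed_form c z n + odd2 n.+1 ^- c ord0 *
    closed_form (fun i => c (lift ord0 i)) (fun i => z (lift ord0 i)) n.+1.
Proof.
move=> c0 c2 z0; rewrite /closed_form /= sum_bweight_rec//; congr (_ + _).
by rewrite sum_bweight_step// mulrA mulKf// expf_neq0// odd2_neq0.
Qed.
End Weights.

(** * Sums over finite functions as nested sums *)

Section FfunSums.
Variable F : numFieldType.

Definition ffcons (T : Type) (d : nat) (x : T) (g : {ffun 'I_d -> T}) :
  {ffun 'I_d.+1 -> T} := [ffun i => oapp g x (unlift ord0 i)].

Lemma ffcons0 (T : Type) d (x : T) (g : {ffun 'I_d -> T}) : ffcons x g ord0 = x.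
Proof. by rewrite ffunE unlift_none. Qed.

Lemma ffconsS (T : Type) d (x : T) (g : {ffun 'I_d -> T}) i :
  ffcons x g (lift ord0 i) = g i.
Proof. by rewrite ffunE liftK. Qed.

Lemma sum_ffun_ordS (T : finType) d (f : {ffun 'I_d.+1 -> T} -> F) :
  \sum_a f a = \sum_x \sum_g f (ffcons x g).
Proof.
rewrite pair_bigA /= (reindex (fun p => ffcons p.1 p.2)) //=.
exists (fun a => (a ord0, [ffun i => a (lift ord0 i)])) => [[x g] _|a _] /=.
  by rewrite ffcons0; congr pair; apply/ffunP => i; rewrite ffunE ffconsS.
apply/ffunP => i; rewrite ffunE.
by case: (unliftP ord0 i) => [j|] -> //=; rewrite ffunE.
Qed.

Lemma oext0 (T : Type) d (f : 'I_d.+1 -> T) x0 : oext f x0 0 = f ord0.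
Proof. by rewrite /oext insubT//=; congr f; apply/val_inj. Qed.

Lemma oextS (T : Type) d (f : 'I_d.+1 -> T) x0 j :
  oext f x0 j.+1 = oext (fun i => f (lift ord0 i)) x0 j.
Proof.
rewrite /oext; case: (ltnP j d) => jd.
  by rewrite !insubT//=; congr f; apply/val_inj.
by rewrite !insubF//; apply/negbTE; rewrite -leqNgt.
Qed.

Lemma oext_ord (T : Type) d (f : 'I_d -> T) x0 (i : 'I_d) : oext f x0 i = f i.
Proof. by rewrite /oext valK. Qed.

Lemma oext_out (T : Type) (f : 'I_0 -> T) x0 j : oext f x0 j = x0.
Proof. by rewrite /oext insubF. Qed.

(** The initial value p is free, unlike in [kprev], so that an induction on d can restart from the
    head of the chain. *)
Definition cprev (n d p : nat) (k : 'I_d -> 'I_n.+1) (i : nat) : nat :=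
  if i is j.+1 then oext (fun o => nat_of_ord (k o)) 0%N j else p.

Fixpoint chain (n d : nat) (W : nat -> nat -> nat -> F) (p : nat) : F :=
  if d is d'.+1 then
    \sum_(x < n.+1) W 0%N p x * chain n d' (fun i => W i.+1) x
  else 1.

(** Each factor couples only neighbours, so the sum factors level by level: removing the head x
    shifts [W] and makes x the new initial value. *)
Lemma sum_ffun_chain n d (W : nat -> nat -> nat -> F) p :
  \sum_(k : {ffun 'I_d -> 'I_n.+1}) \prod_(i < d) W i (cprev p k i) (k i) =
  chain n d W p.
Proof.
elim: d W p => [|d IH] W p /=.
  under eq_bigr do rewrite big_ord0.
  by rewrite sumr_const card_ffun !card_ord expn0.
rewrite sum_ffun_ordS; apply: eq_bigr => x _; rewrite -IH mulr_sumr.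
apply: eq_bigr => g _; rewrite big_ord_recl /= ffcons0; congr (_ * _).
apply: eq_bigr => i _; rewrite ffconsS; congr W.
(* The first entry of the tail is preceded by the head; later entries are preceded by entries of the
   tail. *)
case: i => [[|i] id] /=; rewrite /bump /=.
  by case: d id g {IH} => // d id g; rewrite oext0 ffcons0.
rewrite oextS; congr (oext _ _ _).
by apply/funext => j; rewrite ffconsS.
Qed.

(** By transitivity, comparing neighbours suffices; the constraint thus becomes a product of local
    conditions. Index 0 is exempt because [kprev] is 0 there. *)
Lemma antitone_kprev n d (k : {ffun 'I_d.+1 -> 'I_n.+1}) :
  [forall i : 'I_d.+1, forall j : 'I_d.+1, (i <= j)%N ==> (k j <= k i)%N] &&
  [forall i : 'I_d.+1, (0 < k i)%N] =
  [forall i : 'I_d.+1, (0 < k i)%N && ((i == 0 :> nat) || (k i <= kprev k i)%N)].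
Proof.
apply/andP/forallP => [[/forallP kd /forallP kp] i|kk].
  rewrite kp /=; case: i => [[|i] id] //=.
  have id' : (i < d.+1)%N by apply: ltnW.
  rewrite (oext_ord (fun o => nat_of_ord (k o)) 0%N (Ordinal id')).
  by have /forallP/(_ (Ordinal id))/implyP := kd (Ordinal id'); apply => /=.
split; last by apply/forallP => i; case/andP: (kk i).
apply/forallP => i; apply/forallP => j; apply/implyP => ij.
rewrite -(oext_ord (fun o => nat_of_ord (k o)) 0%N).
rewrite -[X in (_ <= X)%N](oext_ord (fun o => nat_of_ord (k o)) 0%N).
(* Induction on the larger index, descending one neighbour at a time. *)
case: j ij => j /= jd; elim: j jd => [|j IH] jd.
  by rewrite leqn0 => /eqP ->.
rewrite leq_eqVlt => /orP[/eqP ->//|ij].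
apply: leq_trans (IH (ltnW jd) ij).
have /andP[_ /=] := kk (Ordinal jd).
by rewrite (oext_ord (fun o => nat_of_ord (k o)) 0%N (Ordinal jd)).
Qed.
End FfunSums.

(** * Identification of the right-hand side with the closed form *)

Section RightHandSide.
Variable F : numFieldType.
Local Notation odd2 := (odd2 F).

Lemma sum_ord_cond (g : nat -> F) n p : (p <= n)%N ->
  \sum_(x < n.+1) (if (0 < x <= p)%N then g x else 0) = \sum_(1 <= x < p.+1) g x.
Proof.
move=> pn; rewrite -big_mkcond /= (big_nat_widenl 1 0)// (big_nat_widen _ _ n.+1)//.
by rewrite big_mkord.
Qed.

Definition rterm d (c : 'I_d -> nat) (z : 'I_d.+1 -> F) (i p k : nat) : F :=
  (-1) ^+ (k * deltai c i) * odd2 k ^ ((deltai c i)%:Z - 1)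
  / (odd2 k ^+ 2 - oext z 0 i ^+ 2) * Vsharp F p k (nseq (cext c i - 3) 1%N).

(* The constraint 1 <= k_i <= k_(i-1) is moved into the summand, so that the sum over
   chains becomes an unrestricted sum over finite functions. *)
Definition rterm_le d (c : 'I_d -> nat) (z : 'I_d.+1 -> F) (i p k : nat) : F :=
  if (0 < k <= p)%N then rterm c z i p k else 0.

Lemma cextS d (c : 'I_d.+1 -> nat) i :
  cext c i.+2 = cext (fun j => c (lift ord0 j)) i.+1.
Proof. by rewrite /= oextS. Qed.

Lemma rterm_leSS d (c : 'I_d.+1 -> nat) (z : 'I_d.+2 -> F) i :
  rterm_le c z i.+2 =
  rterm_le (fun j => c (lift ord0 j)) (fun j => z (lift ord0 j)) i.+1.
Proof.
apply/funext => p; apply/funext => k; rewrite /rterm_le /rterm /deltai.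
by rewrite !cextS [oext z _ _]oextS.
Qed.

(** The exponent delta_i = delta(c_i) + delta(c_(i+1)) is shared by two steps: [step (c_i)] supplies
    the first part at its inner variable, [step (c_(i+1))] the second at its outer one. The
    outermost variable p therefore shows only delta(c_1). *)
Lemma coef_chain n d (c : 'I_d -> nat) (z : 'I_d.+1 -> F) p : (0 < p <= n)%N ->
  coef c z p =
  (-1) ^+ (p * (1 + delta (cext c 1))) * odd2 p ^ ((delta (cext c 1))%:Z - 1)
  * (-2 * chain n d (fun i => rterm_le c z i.+1) p) / (odd2 p ^+ 2 - z ord0 ^+ 2).
Proof.
elim: d c z p => [|d IH] c z p pn.
  (* Here [cext c 1] is the closing value 0, so delta is 2: the sign is (-1)^(3p) and o(p) has
     exponent 1. *)
  rewrite /= oext_out /= mulr1 mulnC exprM; congr (_ / _).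
  by rewrite (_ : 2 - 1 = 1 :> int)// expr1z exprSr sqrrN expr1n mul1r mulrC.
rewrite [coef _ _ _]/= /step /= oext0; set c1 := c ord0.
rewrite -!mulrA; congr (_ * (_ * _)); rewrite mulrA; congr (_ / _).
under [in RHS]eq_bigr do rewrite /rterm_le /= (fun_if (fun t => t * _)) mul0r.
rewrite (sum_ord_cond (fun x => rterm c z 1 p x *
   chain n d (fun i => rterm_le c z i.+2) x)); last by case/andP: pn.
rewrite mulr_sumr; apply: eq_big_nat => x /andP[x0 xp].
rewrite IH; last by rewrite x0 /=; case/andP: pn => _; apply: leq_trans.
rewrite (_ : (fun i => rterm_le c z i.+2) =
   fun i => rterm_le (fun j => c (lift ord0 j)) (fun j => z (lift ord0 j)) i.+1);
  last by apply/funext => i; rewrite rterm_leSS.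
rewrite /rterm /deltai cextS oextS oext0 [cext c 1]/= oext0 -/c1.
set c2 := cext _ 1; set Ch := chain _ _ _ _; set V := Vsharp _ _ _ _.
have x00 := odd2_neq0 F x.
(* The extra signs (-1)^x of the two adjacent steps cancel. *)
have -> : (-1) ^+ (x * (delta c1 + delta c2)) =
  (-1) ^+ (x * (1 + delta c1)) * (-1) ^+ (x * (1 + delta c2)) :> F.
  rewrite !mulnDr !exprD muln1 mulrACA -[(-1) ^+ x * (-1) ^+ x]expr2.
  by rewrite sqrr_sign mul1r.
have -> : odd2 x ^ ((delta c1 + delta c2)%:Z - 1) =
  odd2 x ^+ delta c1 * odd2 x ^ ((delta c2)%:Z - 1).
  by rewrite PoszD -addrA !expfzDr.
ring.
Qed.

Lemma Grhs_closed_form n d (c : 'I_d -> nat) (z : 'I_d.+1 -> F) :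
  Grhs n c z = closed_form c z n.
Proof.
(* Level 0 carries the binomial and asks only for positivity, since its predecessor 0 is no upper
   bound. *)
pose W i p k := if i is i'.+1 then rterm_le c z i'.+1 p k
  else if (0 < k)%N then 'C(2 * n - 1, n - k)%:R * rterm c z 0 p k else 0.
rewrite /Grhs.
transitivity ((n * 'C(2 * n, n))%:R / 2 ^+ (4 * n - 2) *
    \sum_(k : {ffun 'I_d.+1 -> 'I_n.+1}) \prod_(i < d.+1) W i (cprev 0 k i) (k i)).
  congr (_ * _); rewrite big_mkcond; apply: eq_bigr => k _.
  rewrite antitone_kprev; case: ifPn => [/forallP kk|].
    rewrite !big_ord_recl mulrA; congr (_ * _).
      have /andP[k0 _] := kk ord0.
      by rewrite /W /= k0 /rterm oext0.
    apply: eq_bigr => i _; have /andP[k0 /=] := kk (lift ord0 i).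
    rewrite /W /rterm_le /= k0 => -> /=.
    by rewrite /rterm (oext_ord z 0 (lift ord0 i)).
  (* A violated local condition makes the j-th factor, hence the product, zero. *)
  rewrite negb_forall => /existsP[j]; rewrite negb_and => kj.
  rewrite (bigD1 j)//= (_ : W _ _ _ = 0) ?mul0r//.
  case: j kj => [[|j] jd] kj; rewrite /W /=.
    by move: kj; rewrite orbF; case: ifP.
  by rewrite /rterm_le ifF//; apply/negbTE; rewrite negb_and.
rewrite sum_ffun_chain /= -/(chain n d (fun i => rterm_le c z i.+1) _).
rewrite /closed_form -(sum_ord_cond _ (leqnn n)) mulr_sumr.
apply: eq_bigr => x _; have xn : (x <= n)%N by rewrite -ltnS ltn_ord.
rewrite xn andbT.
case: ifP => x0; last by rewrite mul0r mulr0.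
rewrite (@coef_chain n) ?x0// /bweight /rterm /deltai /= oext0.
have x00 := odd2_neq0 F x.
rewrite -[oext c 0 0]/(cext c 1); set c1 := cext c 1.
rewrite PoszD addrAC subrr add0r.
(* With k_(-1) = 0 the kernel is in its default branch and o(0) = -1; this is the source of the -2
   in [coef]. *)
have -> : Vsharp F 0 x [::] = -2 / odd2 x.
  rewrite /Vsharp /= /tri eq_sym -lt0n x0 expr1 /Defs.odd2 muln0; ring.
by rewrite expfzDr// exprN1 -exprnP; ring.
Qed.
End RightHandSide.

(** * Convergence of the truncated generating functions *)

Section Limits.
Variable C : numFieldType.
Local Notation odd2 := (odd2 C).

Lemma normr_odd2_le k : `|odd2 k.+2 ^- 2| <= 2^-1.
Proof.
rewrite odd2S normfV -natrX normr_nat lef_pV2 ?posrE ?ltr0n ?ler_nat; lia.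
Qed.

Section IteratedSums.
(** An abstraction of [Gtail]: N is the truncation, a the number of leading 2's, and [q] the limit
    without leading 2's. *)
Variables (e : nat -> nat -> nat -> C) (q : nat -> C).
Hypothesis eS : forall N a n,
  e N a.+1 n = \sum_(1 <= k < n.+1) odd2 k ^- 2 * e N a k.
Hypothesis e0q : forall n, e N 0%N n @[N --> \oo] --> q n.

Lemma iter_n0 N a : e N a.+1 0 = 0.
Proof. by rewrite eS big_geq. Qed.

Lemma iter_nS N a n : e N a.+1 n.+1 = e N a.+1 n + odd2 n.+1 ^- 2 * e N a n.+1.
Proof. by rewrite !eS big_nat_recr. Qed.

(** The bound must be uniform in a, since the boundary term of the truncation has a = N. Beyond n =
    1 the factor o(n)^(-2) <= 1/2 contracts. *)
Lemma iter_bounded n :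
  exists2 K : C, 0 <= K & \forall N \near \oo, forall a, `|e N a n| <= K.
Proof.
have e0K m : \forall N \near \oo, `|e N 0%N m| <= `|q m| + 1.
  have /cvgrPdist_lt/(_ 1 ltr01) := @e0q m; apply: filterS => N qe.
  rewrite -[e N 0%N m](subKr (q m)); apply: le_trans (ler_normB _ _) _.
  by rewrite lerD2l ltW.
elim: n => [|[|n] [K K0 IH]].
- exists (`|q 0%N| + 1); first by rewrite addr_ge0.
  apply: filterS (e0K 0%N) => N eN [//|a].
  by rewrite iter_n0 normr0 addr_ge0.
(* There is no contraction at n = 1, but o(1) = 1 and [iter_n0] make [e N a 1] constant in a. *)
- exists (`|q 1%N| + 1); first by rewrite addr_ge0.
  apply: filterS (e0K 1%N) => N eN; elim=> [//|a IHa].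
  by rewrite iter_nS iter_n0 add0r odd2S muln0 add0n expr1n invr1 mul1r.
(* This bound K' satisfies K + K'/2 <= K', so it survives the passage from a to a+1. *)
exists (2 * K + (`|q n.+2| + 1)); first by rewrite !addr_ge0// mulr_ge0.
apply: filterS2 IH (e0K n.+2) => N IH eN; elim=> [|a IHa].
  by apply: (le_trans eN); rewrite lerDr mulr_ge0.
rewrite iter_nS; apply: le_trans (ler_normD _ _) _; rewrite normrM.
apply: (@le_trans _ _ (K + 2^-1 * (2 * K + (`|q n.+2| + 1)))).
  by apply: lerD => //; apply: ler_pM => //; exact: normr_odd2_le.
rewrite mulrDr mulKf ?pnatr_eq0// addrA -mulr2n -[K *+ 2]mulr_natl lerD2l.
by rewrite ler_piMl ?addr_ge0// invf_le1// ler1n.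
Qed.

(** Summing [iter_nS] against y^(2a+2) shifts a by one. The terms a = 0 give the source; the term a
    = N has no successor in the sum and is left as boundary error. *)
Lemma sum_iter_rec (y : C) N n :
  (\sum_(a < N.+1) y ^+ (2 * a) * e N a n.+1) * (1 - y ^+ 2 / odd2 n.+1 ^+ 2) =
  \sum_(a < N.+1) y ^+ (2 * a) * e N a n + (e N 0%N n.+1 - e N 0%N n)
  - y ^+ 2 / odd2 n.+1 ^+ 2 * (y ^+ (2 * N) * e N N n.+1).
Proof.
set S := \sum_(a < N.+1) y ^+ (2 * a) * e N a n.+1.
set v := y ^+ 2 / _.
have E : S = e N 0%N n.+1 + (\sum_(a < N.+1) y ^+ (2 * a) * e N a n - e N 0%N n)
    + v * (S - y ^+ (2 * N) * e N N n.+1).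
  have -> : S - y ^+ (2 * N) * e N N n.+1 = \sum_(a < N) y ^+ (2 * a) * e N a n.+1.
    by rewrite /S big_ord_recr /= addrK.
  rewrite /S !big_ord_recl /= muln0 expr0 !mul1r [e N 0%N n + _]addrC addrK.
  rewrite -addrA; congr (_ + _); rewrite mulr_sumr -big_split /=.
  apply: eq_bigr => a _; rewrite /bump /= add1n iter_nS mulrDr; congr (_ + _).
  by rewrite mulnS exprD /v; ring.
by rewrite mulrBr mulr1 {1}E; ring.
Qed.

(** Induction on n: the boundary error is y^(2N) times a bounded quantity, so in the limit
    [sum_iter_rec] becomes the recursion that defines p. *)
Lemma cvg_sum_iter (y : C) (p : nat -> C) :
    y ^+ N @[N --> \oo] --> (0 : C) ->
    (forall n, 1 - y ^+ 2 / odd2 n.+1 ^+ 2 != 0) ->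
    p 0%N = q 0%N ->
    (forall n, p n.+1 * (1 - y ^+ 2 / odd2 n.+1 ^+ 2) = p n + (q n.+1 - q n)) ->
  forall n, \sum_(a < N.+1) y ^+ (2 * a) * e N a n @[N --> \oo] --> p n.
Proof.
move=> y0 yn p0 pS; elim=> [|n IH].
  rewrite p0; apply: cvg_trans (@e0q 0%N); apply: near_eq_cvg.
  apply: nearW => N; rewrite big_ord_recl /= muln0 expr0 mul1r big1 ?addr0//.
  by move=> a _; rewrite /bump /= add1n iter_n0 mulr0.
have tail : y ^+ (2 * N) * e N N n.+1 @[N --> \oo] --> (0 : C).
  have yy : y ^+ (2 * N) @[N --> \oo] --> (0 : C).
    rewrite -[X in _ --> X](mulr0 0).
    apply: cvg_trans (cvgM y0 y0); apply: near_eq_cvg; apply: nearW => N /=.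
    by rewrite mul2n -addnn exprD.
  have [K K0 eK] := iter_bounded n.+1.
  apply/cvgr0Pnorm_lt => eps eps0.
  have K10 : 0 < K + 1 by rewrite ltr_wpDl.
  have /cvgr0_norm_lt/(_ _ (divr_gt0 eps0 K10)) yK := yy.
  apply: filterS2 eK yK => N eK yN; rewrite normrM.
  apply: (@le_lt_trans _ _ (`|y ^+ (2 * N)| * (K + 1))).
    by apply: ler_wpM2l => //; apply: le_trans (eK N) _; rewrite lerDl.
  by rewrite -ltr_pdivlMr.
have -> : p n.+1 = (p n + (q n.+1 - q n) - y ^+ 2 / odd2 n.+1 ^+ 2 * 0)
    * (1 - y ^+ 2 / odd2 n.+1 ^+ 2)^-1.
  by rewrite mulr0 subr0 -pS mulfK.
have rec : (\sum_(a < N.+1) y ^+ (2 * a) * e N a n + (e N 0%N n.+1 - e N 0%N n)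
      - y ^+ 2 / odd2 n.+1 ^+ 2 * (y ^+ (2 * N) * e N N n.+1))
      * (1 - y ^+ 2 / odd2 n.+1 ^+ 2)^-1 @[N --> \oo] -->
    (p n + (q n.+1 - q n) - y ^+ 2 / odd2 n.+1 ^+ 2 * 0)
      * (1 - y ^+ 2 / odd2 n.+1 ^+ 2)^-1.
  apply: cvgMr_tmp; apply: cvgB; last exact: cvgMl_tmp tail.
  by apply: cvgD IH _; apply: cvgB; exact: e0q.
apply: cvg_trans rec; apply: near_eq_cvg; apply: nearW => N /=.
by rewrite -sum_iter_rec mulfK.
Qed.
End IteratedSums.

(* The partial sum with a_0 = a held fixed. *)
Definition Gtail (d : nat) (c : 'I_d -> nat) (z : 'I_d.+1 -> C) (N a n : nat) : C :=
  \sum_(g : {ffun 'I_d -> 'I_N.+1})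
    tstar C n (nseq a 2%N ++ flatten [seq c i :: nseq (g i) 2%N | i <- enum 'I_d])
    * \prod_(j < d) z (lift ord0 j) ^+ (2 * g j).

Lemma Gpartial_Gtail n d (c : 'I_d -> nat) (z : 'I_d.+1 -> C) N :
  Gpartial n c z N = \sum_(a < N.+1) z ord0 ^+ (2 * a) * Gtail c z N a n.
Proof.
rewrite /Gpartial sum_ffun_ordS; apply: eq_bigr => a _.
rewrite mulr_sumr; apply: eq_bigr => g _.
rewrite big_ord_recl /Gindex ffcons0 mulrCA; congr (_ * (_ * _)).
  by congr (tstar _ _ (_ ++ flatten _)); apply: eq_map => i; rewrite ffconsS.
by apply: eq_bigr => j _; rewrite ffconsS.
Qed.

Lemma GtailS d (c : 'I_d -> nat) (z : 'I_d.+1 -> C) N a n :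
  Gtail c z N a.+1 n = \sum_(1 <= k < n.+1) odd2 k ^- 2 * Gtail c z N a k.
Proof.
rewrite /Gtail /=; under [RHS]eq_bigr do rewrite mulr_sumr.
rewrite exchange_big /=; apply: eq_bigr => g _; rewrite mulr_suml.
by apply: eq_bigr => k _; rewrite mulrA.
Qed.

Lemma Gtail_nil (c : 'I_0 -> nat) (z : 'I_1 -> C) N n : Gtail c z N 0 n = 1.
Proof.
rewrite /Gtail enum_ord0 /=; under eq_bigr do rewrite big_ord0 mulr1.
by rewrite sumr_const card_ffun !card_ord expn0.
Qed.

(** The sum is indexed by k+1 to keep the argument of the shorter generating function visibly
    positive, as [cvg_Gpartial] requires. *)
Lemma Gtail_cons d (c : 'I_d.+1 -> nat) (z : 'I_d.+2 -> C) N n :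
  Gtail c z N 0 n = \sum_(0 <= k < n) odd2 k.+1 ^- c ord0 *
    Gpartial k.+1 (fun i => c (lift ord0 i)) (fun i => z (lift ord0 i)) N.
Proof.
transitivity (\sum_(1 <= k < n.+1) odd2 k ^- c ord0 *
    Gpartial k (fun i => c (lift ord0 i)) (fun i => z (lift ord0 i)) N); last first.
  by rewrite big_add1.
rewrite /Gtail /Gpartial; under [RHS]eq_bigr do rewrite mulr_sumr.
rewrite exchange_big /=; apply: eq_bigr => g _.
rewrite enum_ordSl /= -map_comp mulr_suml.
by apply: eq_bigr => k _; rewrite mulrA.
Qed.

Lemma cvg_Gpartial d (c : 'I_d -> nat) (z : 'I_d.+1 -> C) n :
    (0 < n)%N -> (forall i, (0 < c i)%N && (c i != 2%N)) ->
    (forall j, z j ^+ N @[N --> \oo] --> (0 : C)) ->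
    (forall j k, odd2 k ^+ 2 - z j ^+ 2 != 0) ->
  Gpartial n c z N @[N --> \oo] --> closed_form c z n.
Proof.
have subr_div_neq0 (x : C) m :
    odd2 m ^+ 2 - x ^+ 2 != 0 -> 1 - x ^+ 2 / odd2 m ^+ 2 != 0.
  have o0 := expf_neq0 2 (odd2_neq0 C m).
  by rewrite -[1 - _ == 0](inj_eq (mulIf o0)) mul0r mulrBl mul1r mulfVK.
elim: d c z n => [|d IH] c z n n0 c02 z0 z1; under eq_fun do rewrite Gpartial_Gtail.
  (* At m = 0 [closed_form] is an empty sum, whereas the limit there is 1, contributed by the empty
     index. *)
  pose p m := if m is 0 then 1 else closed_form c z m.
  have -> : closed_form c z n = p n by case: n n0.
  apply: (@cvg_sum_iter _ (fun=> 1)) => // [N a m|m|m|].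
  - exact: GtailS.
  - by under eq_fun do rewrite Gtail_nil; exact: cvg_cst.
  - exact: subr_div_neq0.
  move=> [|m]; rewrite subrr addr0; last exact: closed_form0_rec.
  have e1 : odd2 1 ^+ 2 = 1 by rewrite odd2S muln0 expr1n.
  by rewrite e1 divr1; apply: closed_form0_1; rewrite -e1.
pose c' i := c (lift ord0 i); pose z' i := z (lift ord0 i).
apply: (@cvg_sum_iter _ (fun m => \sum_(0 <= k < m) odd2 k.+1 ^- c ord0 *
   closed_form c' z' k.+1)) => // [N a m|m|m||m].
- exact: GtailS.
- under eq_fun do rewrite Gtail_cons.
  apply: cvg_big; first exact: add_continuous.
  move=> k _; apply: cvgMl_tmp.
  by apply: IH => // i; exact: c02.
- exact: subr_div_neq0.
- by rewrite /closed_form !big_geq.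
(* One increment of the limit sequence is the source term of [closed_formS_rec]. *)
rewrite big_nat_recr//= [X in _ = _ + (X - _)]addrC addrK.
by have /andP[? ?] := c02 ord0; exact: closed_formS_rec.
Qed.
End Limits.

(** * Complex parameters in the open unit disc *)

Lemma complex_cvg_expr (R : realType) (x : R[i]) : `|x| < 1 ->
  (x ^+ N : (R[i] : numFieldType)) @[N --> \oo] --> (0 : (R[i] : numFieldType)).
Proof.
move=> x1; apply/cvgr0Pnorm_lt => eps eps0.
(* In [R[i]] both the modulus and a positive [eps] have zero imaginary part, which reduces the claim
   to a real geometric sequence. *)
pose r := complex.Re `|x|.
have xr : `|x| = r%:C by rewrite /r normc_def.
have r0 : `|r| < 1.
  rewrite ger0_norm; first by rewrite -ltcR -xr.
  by rewrite -lecR -xr normr_ge0.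
have er : eps = (complex.Re eps)%:C.
  by move: eps0; rewrite ltcE; case: eps => a b /= /andP[/eqP -> _].
have e0 : 0 < complex.Re eps by rewrite -ltcR -er.
have /cvgr0_norm_lt/(_ _ e0) := cvg_expr r0; apply: filterS => N rN.
rewrite normrX xr er -rmorphXn ltcR.
exact: le_lt_trans (ler_norm _) rN.
Qed.

(** Moduli differ: [odd2 C k] has modulus at least 1, also at k = 0, where it is -1. *)
Lemma odd2_sqr_neq (C : numFieldType) (x : C) k : `|x| < 1 ->
  odd2 C k ^+ 2 - x ^+ 2 != 0.
Proof.
move=> x1; rewrite subr_eq0; apply/eqP => /(congr1 Num.norm).
rewrite !normrX => e; have : `|x| ^+ 2 < 1 by rewrite exprn_ilt1.
rewrite -e => h; have : 1 <= `|odd2 C k|.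
  case: k {e h} => [|k]; first by rewrite /odd2 muln0 sub0r normrN normr1.
  by rewrite odd2S normr_nat ler1n; lia.
by move=> /(exprn_ege1 2)/le_lt_trans/(_ h); rewrite ltxx.
Qed.

Theorem theorem2p1 (R : realType) (n d : nat) (c : 'I_d -> nat) (z : 'I_d.+1 -> R[i]) :
  (0 < n)%N ->
  (forall i : 'I_d, (0 < c i)%N && (c i != 2%N)) ->
  (forall j : 'I_d.+1, `|z j| < 1) ->
  Gpartial n c z N @[N --> \oo] --> Grhs n c z.
Proof.
move=> n0 c02 z1; rewrite Grhs_closed_form; apply: cvg_Gpartial => //.
- by move=> j; exact: complex_cvg_expr.
- by move=> j k; exact: odd2_sqr_neq.
Qed.
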